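(* Let $G$ be a finite group and $p$ a fixed prime divisor of $|G|$. Then every subgroup of $G$ is a TI-subgroup of $G$ or subnormal in $G$ or has $p'$-order if and only if one of the following statements holds: (1) every subgroup of $G$ of order divisible by $p$ is subnormal in $G$; (2) $p=2$ and $G=Z_q\rtimes\langle a\rangle$ is a Frobenius group with kernel $Z_q$ and complement $\langle a\rangle$, where $q$ is an odd prime and the order $o(a)$ of $a$ is even; (3) $p>2$ and $G=(Z_q)^r\rtimes(P\times H)$ is a Frobenius group with kernel $(Z_q)^r$ and complement $P\times H$, where $q$ is a prime with $q\neq p$ and $r\geq 1$, $P$ is a Sylow $p$-subgroup of $G$ and $P$ is cyclic, $H$ is either a cyclic group or a direct product of the quaternion group $Q_8$ and a cyclic group of odd order, and every non-identity subgroup of $P$ acts irreducibly (by conjugation) on $(Z_q)^r$; (4) $p>2$ and $G=(Z_q)^r\rtimes(Z_p\rtimes H)$ is a Frobenius group with kernel $(Z_q)^r$ and complement $Z_p\rtimes H$, where $q$ is a prime with $q\neq p$ and $r>1$, $Z_p$ is a Sylow $p$-subgroup of $G$, $H$ is either a cyclic group or a direct product of the quaternion group $Q_8$ and a cyclic group of odd order such that $[Z_p,H]\neq 1$, and $Z_p$ acts irreducibly (by conjugation) on $(Z_q)^r$.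
   Context: All groups are finite. A subgroup $H$ of a group $G$ is a TI-subgroup of $G$ if for every $g\in G$, $H^g\cap H=1$ or $H^g\cap H=H$. A subgroup has $p'$-order if its order is not divisible by $p$. $Z_n$ denotes the cyclic group of order $n$, $(Z_q)^r$ the elementary abelian group of order $q^r$, and $Q_8$ the quaternion group of order $8$. *)

(* Defs.v *)
From mathcomp Require Import all_boot all_fingroup all_solvable.
Set Implicit Arguments.
Unset Strict Implicit.
Unset Printing Implicit Defensive.
Local Open Scope group_scope.

Definition TI_subgroup (gT : finGroupType) (H G : {set gT}) : Prop :=
  forall g, g \in G -> (H :^ g :&: H = 1) \/ (H :^ g :&: H = H).

Definition cyclic_or_Q8_x_odd (gT : finGroupType) (H : {set gT}) : Prop :=
  cyclic H \/
  exists Q O : {group gT}, [/\ Q \isog 'Q_8, cyclic O, odd #|O| & Q \x O = H].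

(* Main.v *)
Require Import Defs.
From mathcomp Require Import all_boot all_fingroup ssralg zmodp all_solvable.
From mathcomp Require Import all_character.
Set Implicit Arguments.
Unset Strict Implicit.
Unset Printing Implicit Defensive.
Local Open Scope group_scope.

(** Let P be a Sylow p-subgroup of G. If P is normal, a TI-subgroup X of order
    divisible by p is normalised by N_P(X :&: P), so climbing normalisers in P
    makes X subnormal: this is case (1). If P is not normal, C := N_G(P) is
    self-normalising, hence not subnormal, hence TI: G is a Frobenius group with
    complement C and some kernel K. A subnormal subgroup meeting C nontrivially
    contains K, so for 1 <> A <= P and an A-invariant L with 1 < L < K the
    subgroup LA is TI, which forces N_K(L) = L; this makes K elementary abelian
    and A irreducible on K. All subgroups of C above a normal p-subgroup of C
    are normal in C. If p = 2 an involution inverts K, so |K| is prime and C is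
    cyclic; if p > 2 then P is cyclic with a complement H in C all of whose
    subgroups are normal, which pins down H.
    Conversely, in (2)-(4) every subgroup of C of order divisible by p is normal
    in C and irreducible on K, so a subgroup of G of order divisible by p either
    contains K and is normal, or is conjugate into C and is TI. *)

Section General.

Variable gT : finGroupType.
Implicit Types (A B C D G H K L P Q X Y Z : {group gT}) (p q : nat).

(** * Irreducible action, TI-subgroups and subnormality *)

Lemma acts_irreducibly_conj A K :
  acts_irreducibly A K 'J = minnormal K A.
Proof.
by apply/mingroupP/mingroupP=> /=; rewrite astabsJ => -[nKA minK]; split=> // L;
  move: (minK L); rewrite astabsJ.
Qed.

Lemma minnormalS A B K :
  A \subset B -> B \subset 'N(K) -> minnormal K A -> minnormal K B.
Proof.
move=> sAB nKB /mingroupP[/andP[ntK _] minK].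
apply/mingroupP; split=> [|L /andP[ntL nLB]]; first by rewrite ntK.
by apply: minK; rewrite ntL (subset_trans sAB).
Qed.

Lemma TI_subgroup_norm H G g :
  TI_subgroup H G -> g \in G -> H :^ g :&: H != 1 -> g \in 'N(H).
Proof.
move=> tiH Gg ntI; have [I1|IH] := tiH g Gg; first by rewrite I1 eqxx in ntI.
apply/normP/esym/eqP.
by rewrite eqEcard cardJg leqnn andbT -{1}IH subsetIl.
Qed.

(** An element [g] normalising [L] keeps [L] inside [H :^ g :&: H]. This is how the TI property is
    exploited throughout. *)
Lemma TI_subgroup_norm_sub H G L :
  TI_subgroup H G -> L \subset H -> L :!=: 1 -> 'N_G(L) \subset 'N(H).
Proof.
move=> tiH sLH ntL; apply/subsetP=> g /setIP[Gg nLg].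
apply: (TI_subgroup_norm tiH Gg); apply: subG1_contra ntL.
by rewrite subsetI sLH andbT -{1}(normP nLg) conjSg.
Qed.

Lemma TI_subgroupJ H G x :
  x \in G -> TI_subgroup H G -> TI_subgroup (H :^ x) G.
Proof.
move=> Gx tiH g Gg; have Gy: x * g * x^-1 \in G by rewrite !groupM ?groupV.
have ->: (H :^ x) :^ g :&: H :^ x = (H :^ (x * g * x^-1) :&: H) :^ x.
  by rewrite conjIg -!conjsgM mulgKV.
by case: (tiH _ Gy) => ->; [left; rewrite conjs1g | right].
Qed.

Lemma subnormal_selfnorm H G : H <|<| G -> 'N_G(H) \subset H -> H :=: G.
Proof.
move=> /subnormalEl[-> // | [L [/andP[sHL nHL] snLG /andP[_ /negP nLH]]]] nHH.
case: nLH.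
by apply: subset_trans nHH; rewrite subsetI (subnormal_sub snLG).
Qed.

(* The commutators [k, x] with k in K already fill K, as x fixes no point. *)
Lemma subnormal_sub_regular K X G x :
    x \in 'N(K) -> 'C_K[x] = 1 -> K \subset G -> X <|<| G -> x \in X ->
  K \subset X.
Proof.
move=> nKx regx; elim: {G}_.+1 {-2}G (ltnSn #|G|) => // n IHn G leGn sKG snXG Xx.
have [-> // | [L [snXL nsLG pLG]]] := subnormalEr snXG.
apply: (IHn L) => //; first by apply: leq_trans (proper_card pLG) _.
have Lx: x \in L by apply: subsetP Xx; apply: subnormal_sub.
have inj: {in K &, injective (fun k => [~ k, x])}.
  move=> k l Kk Kl /=; rewrite !commgEl => eq_kl.
  apply/eqP; rewrite eq_mulgV1 -in_set1 -[[set 1]]regx inE groupM ?groupV //=.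
  apply/cent1P/commgP; rewrite -conjg_fix conjMg conjVg.
  by rewrite -[k ^ x](mulKVg k) eq_kl -(mulgA k) mulgK.
have imK: [set [~ k, x] | k in K] = K.
  apply/eqP; rewrite eqEcard card_in_imset // leqnn andbT.
  apply/subsetP=> _ /imsetP[k Kk ->].
  by rewrite commgEl groupM ?groupV ?memJ_norm.
rewrite -imK; apply/subsetP=> _ /imsetP[k Kk ->].
rewrite commgEr groupM // memJ_norm ?groupV //.
by apply: subsetP Kk; apply: subset_trans sKG (normal_norm nsLG).
Qed.

(** * The case of a normal Sylow subgroup *)

Lemma normal_Sylow_meet P A X p :
  prime p -> p.-Sylow(A) P -> P <| A -> X \subset A -> p %| #|X| ->
  X :&: P != 1.
Proof.
move=> p_pr sylP nsPA sXA pX; have [x Xx ox] := Cauchy p_pr pX.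
apply/trivgPn; exists x; last by rewrite -order_gt1 ox prime_gt1.
rewrite inE Xx (mem_normal_Hall sylP) ?(subsetP sXA) // /p_elt ox.
exact: pnat_id.
Qed.

(** Induction on [#|G| - #|X|]. A TI-subgroup [X] above [P] is normalised by ['N_G(P) = G].
    Otherwise normalisers grow in the nilpotent group [P], so [X] is normal in a strictly larger
    subgroup, which is subnormal by induction. *)
Lemma TI_or_subnormal_normal_Sylow G P p :
    prime p -> p.-Sylow(G) P -> P <| G ->
    (forall X, X \subset G -> p %| #|X| -> TI_subgroup X G \/ X <|<| G) ->
  forall X, X \subset G -> p %| #|X| -> X <|<| G.
Proof.
move=> p_pr sylP nsPG hyp X; elim: {X}_.+1 {-2}X (ltnSn (#|G| - #|X|)) => // n.
move=> IHn X leXn sXG pX; have [tiX|//] := hyp X sXG pX.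
have [sPG nPG] := andP nsPG.
have ntI := normal_Sylow_meet p_pr sylP nsPG sXG pX.
have [sPX|nsPX] := boolP (P \subset X).
  apply: normal_subnormal; rewrite /normal sXG.
  apply: subset_trans (TI_subgroup_norm_sub tiX sPX _).
    by rewrite subsetI subxx.
  by apply: subG1_contra ntI; apply: subsetIr.
have ltI: X :&: P \proper P by rewrite properE subsetIr subsetI subxx andbT.
have ltN := nilpotent_proper_norm (pgroup_nil (pHall_pgroup sylP)) ltI.
set N := 'N_P(_) in ltN.
have nXN: N \subset 'N(X).
  apply: subset_trans (TI_subgroup_norm_sub tiX (subsetIl X P) ntI).
  by rewrite setSI.
have sNG: N \subset G by rewrite subIset ?sPG.
apply: (@subnormal_trans _ (X <*> N)).
  by apply: normal_subnormal; rewrite /normal joing_subl join_subG normG.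
(* Were [N] inside [X], it would lie in [X :&: P], against [ltN]. *)
have ltXN: X \proper X <*> N.
  rewrite properE joing_subl join_subG subxx /=; apply: contraNN (proper_subn ltN).
  by rewrite subsetI => ->; rewrite subsetIl.
apply: IHn; last 2 first.
- by rewrite join_subG sXG.
- by apply: dvdn_trans pX (cardSg _); apply: joing_subl.
rewrite ltnS in leXn; apply: leq_trans leXn; apply: ltn_sub2l.
  apply: leq_trans (proper_card ltXN) _.
  by rewrite subset_leq_card // join_subG sXG.
exact: proper_card.
Qed.

(** * Self-normalising TI-subgroups *)

(** If [a] and [a ^ g] are nontrivial elements of [H], then [H :^ g] meets [H] nontrivially, so [g]
    normalises [H] and lies in it. *)
Lemma TI_selfnorm_Frobenius G H :
    TI_subgroup H G -> H \proper G -> H :!=: 1 -> 'N_G(H) \subset H ->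
  [Frobenius G with complement H].
Proof.
move=> tiH /andP[sHG nsGH] ntH nHH.
apply/andP; split; first by apply: contraNneq nsGH => ->.
apply/normedTI_memJ_P; split=> //; first by rewrite setD_eq0 subG1.
move=> a g /setD1P[nta Ha] Gg; rewrite !inE conjg_eq1 nta /=.
apply/idP/idP=> [Hag|Hg]; last by rewrite groupJ.
apply: (subsetP nHH); rewrite inE Gg; apply: (TI_subgroup_norm tiH Gg).
apply/trivgPn; exists (a ^ g); last by rewrite conjg_eq1.
by rewrite inE memJ_conjg Ha.
Qed.

(** [P] contains every p-subgroup of its normaliser, so what normalises ['N_G(P)] also normalises
    [P]. *)
Lemma Sylow_norm_selfnorm G P p :
  p.-Sylow(G) P -> 'N_G('N_G(P)) \subset 'N_G(P).
Proof.
move=> sylP; apply/subsetP=> g /setIP[Gg nNg]; rewrite inE Gg /=.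
have sPN: P \subset 'N_G(P) by rewrite subsetI normG (pHall_sub sylP).
have sylPN: p.-Sylow('N_G(P)) P by rewrite Sylow_subnorm.
have nsPN: P <| 'N_G(P) by rewrite /normal sPN subsetIr.
have sPgN: P :^ g \subset 'N_G(P) by rewrite -(normP nNg) conjSg.
by rewrite inE (sub_normal_Hall sylPN) // pgroupJ (pHall_pgroup sylP).
Qed.


(** * TI and normal subgroups of a Frobenius group *)

Lemma Frobenius_ker_p'group G K C p :
    prime p -> [Frobenius G = K ><| C] -> p %| #|C| -> p^'.-group K.
Proof.
move=> p_pr frobG pC; rewrite /pgroup p'natE //.
apply: contraL (Frobenius_coprime frobG) => pK.
apply/negP=> /(coprime_dvdl pK)/(coprime_dvdr pC).
by rewrite /coprime gcdnn gtn_eqF ?prime_gt1.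
Qed.

Lemma Frobenius_compl_subJ G K C X :
    [Frobenius G = K ><| C] -> solvable K -> X \subset G -> X :&: K = 1 ->
  exists2 x, x \in G & X :^ x \subset C.
Proof.
move=> frobG solK sXG tiXK; have [defG _ _ _ _] := Frobenius_context frobG.
have [nsKG sCG mulKC nKC tiKC] := sdprod_context defG.
have nKX: X \subset 'N(K) := subset_trans sXG (normal_norm nsKG).
(* By Dedekind, [D] is a complement of [K] in [K <*> X], as [X] is. Schur-Zassenhaus makes the two
   conjugate. *)
pose D := (K <*> X :&: C)%G.
have defKX: K * D = K <*> X.
  rewrite /= setIC group_modl ?joing_subl // mulKC.
  by apply/setIidPr; rewrite join_subG normal_sub.
have oD: #|X| = #|D|.
  apply/eqP; rewrite -(eqn_pmul2l (cardG_gt0 K)) -!TI_cardMg //.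
  - by rewrite defKX norm_joinEr.
  - by apply/trivgP; rewrite -tiKC setIS ?subsetIr.
  by rewrite setIC.
have [|||x Kx defX] := SchurZassenhaus_trans_sol solK _ _ _ oD.
- by rewrite subIset // nKC orbT.
- by rewrite defKX joing_subr.
- apply: coprimegS (Frobenius_coprime frobG); exact: subsetIr.
exists x^-1; first by rewrite groupV (subsetP (normal_sub nsKG)).
by rewrite defX conjsgK subsetIr.
Qed.

Lemma Frobenius_compl_norm_TI G K C Y :
  [Frobenius G = K ><| C] -> Y <| C -> TI_subgroup Y G.
Proof.
move=> /andP[_ /andP[_ /normedTI_memJ_P[_ sCG tiC]]] /andP[sYC nYC] g Gg.
have [->|/trivgPn[y /setIP[Yyg Yy] nty]] := eqVneq (Y :^ g :&: Y) 1; first by left.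
right; suffices Cg: g \in C by rewrite (normsP nYC) ?setIid.
have C1y: y ^ g^-1 \in C^#.
  by rewrite !inE conjg_eq1 nty -mem_conjg (subsetP _ _ Yyg) // conjSg.
by rewrite -(tiC _ g C1y) // conjgKV !inE nty (subsetP sYC).
Qed.

Lemma Frobenius_TI_or_normal G K C p :
    prime p -> p %| #|C| -> [Frobenius G = K ><| C] -> solvable K ->
    (forall Y, Y \subset C -> p %| #|Y| -> Y <| C /\ minnormal K Y) ->
  forall X, X \subset G -> p %| #|X| -> TI_subgroup X G \/ X <| G.
Proof.
move=> p_pr pC frobG solK hypC X sXG pX.
have [defG _ _ _ _] := Frobenius_context frobG.
have [nsKG sCG mulKC nKC tiKC] := sdprod_context defG.
have [tiXK|ntXK] := eqVneq (X :&: K) 1.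
  have [x Gx sXxC] := Frobenius_compl_subJ frobG solK sXG tiXK.
  have [|nXC _] := hypC (X :^ x)%G sXxC; first by rewrite cardJg.
  left; rewrite -(conjsgK x X) -/(gval (X :^ x)%G).
  by apply: TI_subgroupJ; rewrite ?groupV //; apply: Frobenius_compl_norm_TI frobG _.
(* A conjugate of [<[z]>] lies in [C], so it acts irreducibly on [K]. It normalises the
   corresponding conjugate of [X :&: K], which is nontrivial and hence all of [K]. *)
have [z Xz oz] := Cauchy p_pr pX.
have p'K: ~~ (p %| #|K|).
  by rewrite -p'natE //; apply: Frobenius_ker_p'group frobG pC.
have tizK: <[z]> :&: K = 1.
  by apply: coprime_TIg; rewrite -orderE oz prime_coprime.
have szG: <[z]> \subset G by rewrite cycle_subG (subsetP sXG).
have [x Gx szxC] := Frobenius_compl_subJ frobG solK szG tizK.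
have [|_ /mingroupP[_ minK]] := hypC (<[z]> :^ x)%G szxC.
  by rewrite cardJg -orderE oz.
have nKG := normal_norm nsKG.
have Kx: K :^ x = K by apply: (normsP nKG).
have IK: X :^ x :&: K = K.
  apply: (minK (X :^ x :&: K)%G); rewrite /= ?subsetIr //.
  rewrite -[in _ != 1]Kx -conjIg -subG1 sub_conjg conjs1g subG1 ntXK /=.
  rewrite normsI //; last exact: subset_trans szxC nKC.
  by rewrite normJ conjSg cycle_subG (subsetP (normG X)).
have sKX: K \subset X by rewrite -(conjSg _ _ x) Kx -IK subsetIl.
have defX: K * (X :&: C) = X.
  by rewrite setIC group_modl // mulKC; apply/setIidPr.
have [|nsXC _] := hypC (X :&: C)%G (subsetIr _ _).
  have:= pX; rewrite -{1}defX TI_cardMg ?Euclid_dvdM // ?(negPf p'K) //.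
  by apply/trivgP; rewrite -tiKC setIS ?subsetIr.
right; rewrite /normal sXG -{1}mulKC mul_subG ?(subset_trans sKX) ?normG //.
by rewrite -defX normsM // normal_norm.
Qed.

(** * Groups all of whose subgroups are normal *)

Lemma cyclic_normal_subgroups A :
    (forall x, x \in A -> <[x]> <| A) -> forall X, X \subset A -> X <| A.
Proof.
move=> nsA X sXA; rewrite /normal sXA; apply/normsP=> a Aa; apply/normP.
rewrite inE; apply/subsetP=> _ /imsetP[x Xx ->].
have /normal_norm/subsetP/(_ a Aa) nxa := nsA x (subsetP sXA x Xx).
have: x ^ a \in <[x]> by rewrite memJ_norm ?cycle_id.
by apply: subsetP; rewrite cycle_subG.
Qed.

Lemma Q8_normal_subgroups A X : A \isog 'Q_8 -> X \subset A -> X <| A.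
Proof.
move=> isoA; apply: cyclic_normal_subgroups => x Ax.
have oA: #|A| = (2 ^ 3)%N by rewrite (card_isog isoA) (@card_quaternion 3).
have pA: 2.-group A by rewrite /pgroup oA pnatX.
have /dvdn_pfactor[//|k lek3 ox]: #[x] %| 2 ^ 3 by rewrite -oA order_dvdG.
have sxA: <[x]> \subset A by rewrite cycle_subG.
(* Orders 1, 2, 4 and 8. A subgroup of order 2 is ['Ohm_1(A)], one of order 4 has index 2, and order
   8 would give all of [A]. *)
case: k lek3 ox => [|[|[|[|//]]]] _ ox.
- by rewrite (eqP (_ : x == 1)) ?cycle1 ?normal1 // -order_eq1 ox.
- have ntA: A :!=: 1 by rewrite -cardG_gt1 oA.
  have oO: #|'Ohm_1(A)| = 2.
    apply/(prime_Ohm1P pA ntA)/orP; right; rewrite eqxx /=; apply/eqP.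
    by apply/quaternion_classP; exists 3.
  suffices ->: <[x]> = 'Ohm_1(A) by apply: gFnormal.
  apply/eqP; rewrite eqEcard oO -orderE ox andbT cycle_subG /= Ohm1Eprime.
  by rewrite mem_gen // inE Ax ox.
- by apply: index2_normal; rewrite // -divgS // oA -orderE ox.
suffices ->: <[x]> = A by apply: normal_refl.
by apply/eqP; rewrite eqEcard sxA -orderE ox oA.
Qed.

(** By coprimality [<[a * b]>] is the product of [<[a]>], normal in [A] and centralised by [B], and
    [<[b]>], centralised by both factors. *)
Lemma dprod_coprime_normal_subgroups A B D X :
    A \x B = D -> coprime #|A| #|B| ->
    (forall Y, Y \subset A -> Y <| A) -> abelian B -> X \subset D -> X <| D.
Proof.
move=> defD coAB nsA cBB; apply: cyclic_normal_subgroups => x Dx.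
have [_ defAB cAB _] := dprodP defD; rewrite /normal cycle_subG Dx /=.
move: Dx; rewrite -defAB => /mulsgP[a b Aa Bb ->].
have cab: commute a b by apply/commute_sym/(centsP cAB).
have sbB: <[b]> \subset B by rewrite cycle_subG.
have saA: <[a]> \subset A by rewrite cycle_subG.
rewrite cycleM ?(coprimeSg saA) ?(coprimegS sbB) //.
have cAb: A \subset 'C(<[b]>) by rewrite centsC (subset_trans sbB).
have cBa: B \subset 'C(<[a]>) by rewrite (subset_trans cAB) ?centS.
have cBb: B \subset 'C(<[b]>) by rewrite (subset_trans cBB) ?centS.
apply: mul_subG; first by rewrite normsM ?(cents_norm cAb) ?normal_norm ?nsA.
by rewrite normsM ?(cents_norm cBa) ?(cents_norm cBb).
Qed.

Lemma cyclic_or_Q8_x_odd_normal_subgroups A X :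
  cyclic_or_Q8_x_odd A -> X \subset A -> X <| A.
Proof.
case=> [cycA|[Q [O [isoQ cycO oddO defA]]]].
  by rewrite sub_abelian_normal ?cyclic_abelian.
apply: dprod_coprime_normal_subgroups defA _ _ (cyclic_abelian cycO).
  by rewrite (card_isog isoQ) (@card_quaternion 3) // (@coprimeXl 3 2) // coprime2n.
by move=> Y; apply: Q8_normal_subgroups.
Qed.

Lemma dprod_cyclic_normal_subgroups P A D X :
    cyclic P -> odd #|P| -> P \x A = D -> cyclic_or_Q8_x_odd A ->
  X \subset D -> X <| D.
Proof.
move=> cycP oddP defD [cycA|[Q [O [isoQ cycO oddO defA]]]].
  have [_ mulD cPA _] := dprodP defD.
  by rewrite sub_abelian_normal // -mulD abelianM !cyclic_abelian.
(* Regroup as a quaternion group times an abelian group of odd order. *)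
have defD' : Q \x (O \x P) = D by rewrite dprodA defA dprodC.
have [[_ B _ defB] _ _ _] := dprodP defD'; rewrite defB in defD'.
have [_ mulB cOP tiB] := dprodP defB.
apply: dprod_coprime_normal_subgroups defD' _ _ _.
- rewrite (card_isog isoQ) (@card_quaternion 3) // (@coprimeXl 3 2) // coprime2n.
  by rewrite -(dprod_card defB) oddM oddO.
- by move=> Y; apply: Q8_normal_subgroups.
by rewrite -mulB abelianM !cyclic_abelian.
Qed.



(** * Frobenius complements acting on an abelian kernel *)

(** A minimal [A]-invariant subgroup of [K] is an irreducible module, faithful because the action is
    fixed-point-free. An abelian group with a faithful irreducible module is cyclic. *)
Lemma Frobenius_compl_abelian_cyclic G K C A q :
    [Frobenius G = K ><| C] -> prime q -> q.-abelem K ->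
  A \subset C -> abelian A -> cyclic A.
Proof.
move=> frobG q_pr abelK sAC cAA.
have [->|ntA] := eqVneq A 1%G; first exact: cyclic1.
have [defG ntK _ _ _] := Frobenius_context frobG.
have [_ _ _ nKC _] := sdprod_context defG.
have nKA := subset_trans sAC nKC.
have [V minV sVK]: {V : {group gT} | minnormal V A & V \subset K}.
  by apply: mingroup_exists; rewrite ntK.
have [/andP[ntV nVA] _] := mingroupP minV.
have abelV := abelemS sVK abelK.
have regA: 'C_A(V) = 1.
  apply: (cent_semiregular (K := A) (H := V)) => //.
  exact: semiregularS sAC sVK (Frobenius_reg_compl frobG).
have ffulA := abelem_mx_faithful abelV ntV nVA regA.
apply: (mx_faithful_irr_abelian_cyclic (F := 'F_q)) ffulA _ cAA.
exact/abelem_mx_irrP.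
Qed.

Lemma Frobenius_compl_rank1 G K C A q r :
    [Frobenius G = K ><| C] -> prime q -> q.-abelem K -> A \subset C ->
  'r_r(A) <= 1.
Proof.
move=> frobG q_pr abelK sAC; rewrite leqNgt; apply/negP=> /p_rank_geP[E].
case/pnElemP=> sEA abelE dimE.
have := Frobenius_compl_abelian_cyclic frobG q_pr abelK (subset_trans sEA sAC).
by rewrite (abelem_abelian abelE) (abelem_cyclic abelE) dimE => /(_ isT).
Qed.

(** As [K] is abelian, [t] fixes [k * k ^ t], and [t] fixes only the identity of [K]. *)
Lemma Frobenius_invol_inverts G K C t :
    [Frobenius G = K ><| C] -> abelian K -> t \in C -> #[t] = 2 ->
  {in K, forall k, k ^ t = k^-1}.
Proof.
move=> frobG cKK Ct ot k Kk.
have [defG _ _ _ _] := Frobenius_context frobG.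
have [_ _ _ nKC _] := sdprod_context defG.
have Kkt: k ^ t \in K by rewrite memJ_norm ?(subsetP nKC).
have nt_t: t \in C^# by rewrite !inE Ct andbT -order_gt1 ot.
apply/eqP; rewrite eq_sym eq_invg_mul; apply/eqP/set1gP.
rewrite -(Frobenius_reg_ker frobG nt_t) inE groupM //=.
apply/cent1P/commgP; rewrite -conjg_fix conjMg -conjgM -expg2 -ot expg_order.
by rewrite conjg1 (centsP cKK).
Qed.

(** Two involutions of [A] both invert [K], so their quotient centralises [K] and is trivial: the
    involution is unique. *)
Lemma Frobenius_compl_2group_Ohm1 G K C A :
    [Frobenius G = K ><| C] -> abelian K -> A \subset C -> 2.-group A ->
  A :!=: 1 -> #|'Ohm_1(A)| = 2.
Proof.
move=> frobG cKK sAC pA ntA.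
have [_ ntK _ _ _] := Frobenius_context frobG.
have [_ dv2A _] := pgroup_pdiv pA ntA.
have [//|t At ot] := Cauchy _ dv2A.
suffices ->: 'Ohm_1(A) = <[t]> by rewrite -orderE.
apply/eqP; rewrite eqEsubset Ohm1Eprime cycle_subG gen_subG.
rewrite (mem_gen (_ : t \in _)) ?inE ?At ?ot // andbT.
apply/subsetP=> u; rewrite inE => /andP[Au ou'].
have ou: #[u] = 2.
  have: #[u] \in (2 : nat_pred) by apply: (pgroupP pA) ou' (order_dvdG Au).
  by rewrite inE => /eqP.
have inv := Frobenius_invol_inverts frobG cKK.
suffices: u * t^-1 \in 'C_C(K).
  rewrite (cent_semiregular (Frobenius_reg_compl frobG)) // => /set1gP/eqP.
  by rewrite -eq_mulgV1 => /eqP->; apply: cycle_id.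
rewrite inE groupM ?groupV ?(subsetP sAC) //=.
apply/centP=> k Kk; apply/esym/commgP; rewrite -conjg_fix conjgM.
rewrite (inv u) ?(subsetP sAC) // -{1}(invgK k) -(inv t) ?groupV ?(subsetP sAC) //.
by rewrite conjgK invgK.
Qed.

Lemma faithful_prime_cyclic K C :
  prime #|K| -> C \subset 'N(K) -> 'C_C(K) = 1 -> cyclic C.
Proof.
move=> prK nKC regC.
have inj: 'injm (restrm nKC (conj_aut K)).
  by rewrite ker_restrm ker_conj_aut regC.
rewrite -(injm_cyclic inj) // restrmEsub //.
by apply: cyclicS (Aut_prime_cyclic prK); apply: Aut_conj_aut.
Qed.

Lemma normal_subgroups_nilpotent H :
  (forall X, X \subset H -> X <| H) -> nilpotent H.
Proof.
move=> nsH; apply: nilpotentS (Fitting_nil H).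
rewrite -{1}(Sylow_gen H) gen_subG; apply/bigcupsP=> S /SylowP[r _ sylS].
by rewrite Fitting_max ?nsH ?(pHall_sub sylS) // (pgroup_nil (pHall_pgroup sylS)).
Qed.

(** For a noncentral [y] of order 4 outside the cyclic maximal subgroup [<[x]>], normality of
    [<[y]>] puts [[~ x, y] = x ^- 2] in it. If [n > 3], then [x ^+ 2] has order at least 4 and
    generates [<[y]>], which forces [y] into [<[x]>]. *)
Lemma quaternion_normal_subgroups Q n :
    2 < n -> Q \isog 'Q_(2 ^ n) -> (forall X, X \subset Q -> X <| Q) -> n = 3.
Proof.
move=> n_gt2 isoQ nsQ; apply/eqP; rewrite eqn_leq n_gt2 andbT leqNgt.
apply/negP=> n_gt3.
have [[x y] [_ Qx ox /setDP[Qy x'y]] [oy _ xy]] := generators_quaternion n_gt2 isoQ.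
have /andP[_ /subsetP/(_ x Qx) nyx]: <[y]> <| Q by rewrite nsQ ?cycle_subG.
have yx2: x ^- 2 \in <[y]>.
  have ->: x ^- 2 = y^-1 ^ x * y by rewrite -commgEr commgEl xy -invMg.
  by rewrite groupM ?memJ_norm ?groupV ?cycle_id.
case/negP: x'y; have /subsetP: <[y]> \subset <[x]>; last by apply; apply: cycle_id.
apply: subset_trans (cycleX x 2).
have ox2 : #[x ^+ 2] = (2 ^ n.-2)%N.
  have def_n: n.-1 = n.-2.+1 by rewrite -(subnKC n_gt3).
  by rewrite orderXdiv ox def_n expnS ?mulKn ?dvdn_mulr.
suffices /eqP->: <[x ^+ 2]> == <[y]> by [].
rewrite eqEcard cycle_subG -groupV yx2 -!orderE oy ox2.
by rewrite (@leq_exp2l 2 2) // -(subnKC n_gt3).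
Qed.

(** [H] is nilpotent, hence ['O_2(H) \x 'O_2^'(H)]. Sylow subgroups of odd order have rank at most
    1, so the second factor is cyclic. The first, if nontrivial, has a unique involution, so it is
    cyclic or generalised quaternion, and then only ['Q_8] has all subgroups normal. *)
Lemma Frobenius_compl_cyclic_or_Q8_x_odd G K C H q :
    [Frobenius G = K ><| C] -> prime q -> q.-abelem K -> H \subset C ->
    (forall X, X \subset H -> X <| H) -> cyclic_or_Q8_x_odd H.
Proof.
move=> frobG q_pr abelK sHC nsH; have nilH := normal_subgroups_nilpotent nsH.
have defH := nilpotent_pcoreC 2 nilH.
have sOH := pcore_sub 2^' H; have sSH := pcore_sub 2 H.
have oddO: odd #|'O_2^'(H)| by rewrite odd_2'nat; apply: pcore_pgroup.
have cycO: cyclic 'O_2^'(H).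
  apply: nil_Zgroup_cyclic (nilpotentS sOH nilH).
  apply/forall_inP=> V /SylowP[r _ sylV]; have sVO := pHall_sub sylV.
  rewrite (odd_pgroup_rank1_cyclic (pHall_pgroup sylV) (oddSg sVO oddO)).
  apply: Frobenius_compl_rank1 frobG q_pr abelK _.
  exact: subset_trans sVO (subset_trans sOH sHC).
have [cycS|ncycS] := boolP (cyclic 'O_2(H)).
  by left; rewrite (cyclic_dprod defH) // coprime_pcoreC.
have ntS: 'O_2(H) != 1 by apply: contraNneq ncycS => ->; apply: cyclic1.
have oS := Frobenius_compl_2group_Ohm1 frobG (abelem_abelian abelK)
             (subset_trans sSH sHC) (pcore_pgroup 2 H) ntS.
have := introT (prime_Ohm1P (pcore_pgroup 2 H) ntS) oS.
rewrite (negPf ncycS) /= => /eqP/quaternion_classP[n n_gt2 isoS].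
right; exists 'O_2(H)%G, 'O_2^'(H)%G; split=> //.
rewrite -[8]/(2 ^ 3)%N -(quaternion_normal_subgroups n_gt2 isoS) // => X sXS.
by apply: normalS (nsH X _); rewrite ?(subset_trans sXS).
Qed.

(** * Coprime action on a cyclic p-group *)

(** Let [x] generate [P]. As [[~ x, h]] lies in [Z], of order [p], [H] centralises [x ^+ p]. Since
    [Z] is not [P], [x ^+ p] is nontrivial, so [<[x ^+ p]>] contains [Z] and [H] centralises
    [[~: P, H]]. Coprime action on an abelian group leaves no nontrivial fixed point there. *)
Lemma cyclic_Sylow_coprime_comm1 P H Z p :
    cyclic P -> p.-group P -> Z :=: 'Ohm_1(P) -> Z :!=: P ->
    H \subset 'N(P) -> coprime #|P| #|H| -> [~: P, H] \subset Z ->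
  [~: P, H] = 1.
Proof.
move=> cycP pP defZ neZP nPH coPH sPHZ; have cPP := cyclic_abelian cycP.
have sZP: Z \subset P by rewrite defZ Ohm_sub.
have [P1|ntP] := eqVneq (P : {set gT}) 1; first by rewrite P1 comm1G.
have [p_pr _ _] := pgroup_pdiv pP ntP.
have oZ: #|Z| = p by rewrite defZ (Ohm1_cyclic_pgroup_prime cycP pP ntP).
have [x defP] := cyclicP cycP.
have Px: x \in P by rewrite defP cycle_id.
have ntxp: x ^+ p != 1.
  apply: contraNneq neZP => xp1; rewrite eqEcard sZP oZ defP -orderE.
  by rewrite dvdn_leq ?prime_gt0 // order_dvdn xp1.
have cHxp: H \subset 'C[x ^+ p].
  apply/subsetP=> h Hh; apply/cent1P/esym/commgP; rewrite -conjg_fix conjXg.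
  have Zw: [~ x, h] \in Z by rewrite (subsetP sPHZ) ?mem_commg.
  rewrite -[x ^ h](mulKVg x) -commgEl expgMn; last first.
    by apply: (centsP cPP) => //; apply: (subsetP sZP).
  by rewrite (_ : [~ x, h] ^+ p = 1) ?mulg1 // -oZ expg_cardG.
have sZxp: Z \subset <[x ^+ p]>.
  apply: prime_meetG; rewrite ?oZ // setIC defZ; apply: meet_Ohm1.
  by rewrite (setIidPl _) ?cycle_subG ?groupX // cycle_eq1.
have cZH: [~: P, H] \subset 'C(H).
  by rewrite (subset_trans sPHZ) // (subset_trans sZxp) // cycle_subG -sub_cent1.
by rewrite -(coprime_abel_cent_TI nPH coPH cPP); apply/esym/setIidPl.
Qed.

Lemma odd_pgroup_gt2 P p : prime p -> 2 < p -> p.-group P -> odd #|P|.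
Proof.
move=> p_pr p_gt2 /p_natP[k ->]; rewrite oddX.
by case: (even_prime p_pr) p_gt2 => [->|->] //; rewrite orbT.
Qed.

(** * From a nonnormal Sylow subgroup to a Frobenius group *)

Lemma nonnormal_Sylow_Frobenius G P p :
    p.-Sylow(G) P -> p %| #|G| -> ~~ (P <| G) ->
    (forall X, X \subset G -> p %| #|X| -> TI_subgroup X G \/ X <|<| G) ->
  exists K : {group gT}, [Frobenius G = K ><| 'N_G(P)].
Proof.
move=> sylP pG nnPG hypG; have [sPG pP _] := and3P sylP.
have ntP: P :!=: 1 by apply: contraNneq nnPG => ->; apply: normal1.
have [_ dvP _] := pgroup_pdiv pP ntP.
have sPC: P \subset 'N_G(P) by rewrite subsetI sPG normG.
have selfC := Sylow_norm_selfnorm sylP.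
have neCG: 'N_G(P) != G.
  by apply: contraNneq nnPG => <-; rewrite normalSG.
have [tiC|snC] := hypG 'N_G(P)%G (subsetIl _ _) (dvdn_trans dvP (cardSg sPC)).
  have [|K frobG] := @Frobenius_kernel_exists _ G 'N_G(P)%G; last by exists K.
  apply: TI_selfnorm_Frobenius selfC; rewrite //= ?properEneq ?neCG ?subsetIl //.
  exact: subG1_contra ntP.
by have /= eqCG := subnormal_selfnorm snC selfC; rewrite eqCG eqxx in neCG.
Qed.

(** * Kernel and complement under the TI-or-subnormal hypothesis *)

Section Kernel.

Variables (G K C : {group gT}) (p : nat).
Hypotheses (p_pr : prime p) (frobG : [Frobenius G = K ><| C]).
Hypothesis pC : p %| #|C|.
Hypothesis hypG :
  forall X, X \subset G -> p %| #|X| -> TI_subgroup X G \/ X <|<| G.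

Lemma subnormal_sub_Frobenius_ker X A :
  X <|<| G -> A \subset C -> A :!=: 1 -> A \subset X -> K \subset X.
Proof.
move=> snX sAC /trivgPn[x Ax ntx] sAX.
have [defG _ _ _ _] := Frobenius_context frobG.
have [nsKG _ _ nKC _] := sdprod_context defG.
apply: subnormal_sub_regular (normal_sub nsKG) snX (subsetP sAX x Ax).
  by rewrite (subsetP nKC) ?(subsetP sAC).
by apply: (Frobenius_reg_ker frobG); rewrite !inE ntx (subsetP sAC).
Qed.

(** If [L <*> A] were subnormal it would contain [K], and Dedekind would give [K = L]. *)
Lemma ker_invariant_TI A L :
    A \subset C -> p.-group A -> A :!=: 1 -> A \subset 'N(L) ->
  L \proper K -> TI_subgroup (L <*> A) G.
Proof.
move=> sAC pA ntA nLA /andP[sLK nsKL].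
have [defG _ _ _ _] := Frobenius_context frobG.
have [nsKG sCG _ nKC tiKC] := sdprod_context defG.
have [||//|snLA] := @hypG (L <*> A)%G.
- by rewrite join_subG (subset_trans sLK (normal_sub nsKG)) (subset_trans sAC).
- have [_ dvA _] := pgroup_pdiv pA ntA.
  by apply: dvdn_trans dvA (cardSg _); apply: joing_subr.
have := subnormal_sub_Frobenius_ker snLA sAC ntA (joing_subr _ _).
rewrite /= norm_joinEr // => sKLA; case/negP: nsKL.
rewrite -(setIidPl sKLA) setIC -group_modl //.
have tiAK: A :&: K = 1 by apply/trivgP; rewrite -tiKC /= setIC setIS.
by rewrite tiAK mulg1.
Qed.

(** A Frattini argument. An [m] in ['N_K(L)] normalises the TI-subgroup [L <*> A], whose Sylow
    p-subgroup is [A], so [A :^ m = A :^ l] for some [l] in [L]. Then [m * l^-1] lies in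
    ['N_K(A) = 'C_K(A) = 1]. *)
Lemma ker_invariant_selfnorm A L :
    A \subset C -> p.-group A -> A :!=: 1 -> A \subset 'N(L) ->
  L \proper K -> L :!=: 1 -> 'N_K(L) \subset L.
Proof.
move=> sAC pA ntA nLA ltLK ntL; have sLK := proper_sub ltLK.
have [defG _ _ _ _] := Frobenius_context frobG.
have [nsKG sCG _ nKC tiKC] := sdprod_context defG.
have tiLA := ker_invariant_TI sAC pA ntA nLA ltLK.
have sKG := normal_sub nsKG.
apply/subsetP=> m /setIP[Km nLm].
have nLAm: m \in 'N(L <*> A).
  apply: (subsetP (TI_subgroup_norm_sub tiLA (joing_subl _ _) ntL)).
  by rewrite inE (subsetP sKG).
have sylA: p.-Sylow(L <*> A) A.
  rewrite pHallE joing_subr /= norm_joinEr // TI_cardMg; last first.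
    by apply/trivgP; rewrite -tiKC setISS.
  rewrite partnM ?cardG_gt0 // part_p'nat ?mul1n ?part_pnat_id //.
  exact: pgroupS sLK (Frobenius_ker_p'group p_pr frobG pC).
have sylAm: p.-Sylow(L <*> A) (A :^ m)%G.
  by rewrite -(normP nLAm) pHallJ2.
have [y LAy defAm] := Sylow_trans sylA sylAm.
move: LAy; rewrite /= norm_joinEr // -(normC nLA) => /mulsgP[a l Aa Ll def_y].
have {}defAm: A :^ m = A :^ l.
  by rewrite defAm /= def_y conjsgM conjGid.
suffices: m * l^-1 \in 'N_K(A).
  rewrite (coprime_norm_cent (subset_trans sAC nKC)); last first.
    exact: coprimegS (Frobenius_coprime frobG).
  rewrite (cent_semiregular (Frobenius_reg_ker frobG)) // => /set1gP/eqP.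
  by rewrite -eq_mulgV1 => /eqP->.
rewrite inE groupM ?groupV ?(subsetP sLK l Ll) //=.
by apply/normP; rewrite conjsgM defAm conjsgK.
Qed.

(* A Sylow subgroup Q < K normalised by A would be a self-normalising TI
   subgroup of K; the resulting Frobenius kernel of K is A-invariant and normal in K,
   hence not self-normalising. *)
Lemma Frobenius_ker_abelem A :
  A \subset C -> p.-group A -> A :!=: 1 -> exists2 q, prime q & q.-abelem K.
Proof.
move=> sAC pA ntA; have [defG ntK _ _ _] := Frobenius_context frobG.
have [nsKG sCG _ nKC tiKC] := sdprod_context defG.
have nKA := subset_trans sAC nKC.
have not_char L : L \char K -> L \proper K -> L :==: 1.
  move=> chL ltLK; apply: contraT => ntL.
  have := ker_invariant_selfnorm sAC pA ntA _ ltLK ntL.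
  move/(_ (char_norm_trans chL nKA)); rewrite (setIidPl (char_norm chL)).
  by rewrite (negPf (proper_subn ltLK)).
set q := pdiv #|K|; have q_pr: prime q by rewrite pdiv_prime ?cardG_gt1.
exists q => //.
have [|Q sylQ nQA] := @sol_coprime_Sylow_exists _ q A K (pgroup_sol pA) nKA.
  exact: coprimegS (Frobenius_coprime frobG).
have ntQ: Q :!=: 1.
  by rewrite -cardG_gt1 (card_Hall sylQ) p_part_gt1 pi_pdiv cardG_gt1.
have sQK := pHall_sub sylQ.
(* If [K] is a q-group, its Frattini subgroup is characteristic and proper, hence trivial. *)
have [defQ|neQK] := eqVneq (Q : {set gT}) K.
  have qK: q.-group K by rewrite -defQ (pHall_pgroup sylQ).
  rewrite -(trivg_Phi qK); apply: not_char; first exact: Phi_char.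
  exact: Phi_proper.
have ltQK: Q \proper K by rewrite properEneq neQK.
have tiQA := ker_invariant_TI sAC pA ntA nQA ltQK.
have defQ: K :&: (Q <*> A) = Q.
  rewrite norm_joinEr // setIC -group_modl //.
  have tiAK: A :&: K = 1 by apply/trivgP; rewrite -tiKC /= setIC setIS.
  by rewrite tiAK mulg1.
have tiQ: TI_subgroup Q K.
  move=> k Kk; have Gk := subsetP (normal_sub nsKG) k Kk.
  have [->|ntI] := eqVneq (Q :^ k :&: Q) 1; first by left.
  have nQAk: k \in 'N(Q <*> A).
    apply: (TI_subgroup_norm tiQA Gk); apply: subG1_contra ntI.
    by rewrite setISS ?conjSg ?joing_subl.
  have Qk: Q :^ k = Q by rewrite -{1}defQ conjIg (normP nQAk) conjGid.
  by right; rewrite Qk setIid.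
have frobK: [Frobenius K with complement Q].
  apply: TI_selfnorm_Frobenius => //.
  exact: (ker_invariant_selfnorm sAC pA ntA nQA ltQK ntQ).
have [M frobM] := Frobenius_kernel_exists frobK.
have [defK ntM _ ltMK _] := Frobenius_context frobM.
have [nsMK _ _ _ _] := sdprod_context defK.
have hallM := Hall_pi (Frobenius_ker_Hall frobM).
have chM: M \char K by rewrite -(normal_Hall_pcore hallM nsMK) pcore_char.
by rewrite (not_char M chM ltMK) in ntM.
Qed.

Lemma Frobenius_ker_minnormal A :
    abelian K -> A \subset C -> p.-group A -> A :!=: 1 -> minnormal K A.
Proof.
move=> cKK sAC pA ntA; have [defG ntK _ _ _] := Frobenius_context frobG.
have [_ _ _ nKC _] := sdprod_context defG.
apply/mingroupP; rewrite ntK (subset_trans sAC) //; split=> // L.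
case/andP=> ntL nLA sLK; apply/eqP; rewrite eqEproper sLK /=; apply/negP=> ltLK.
have := ker_invariant_selfnorm sAC pA ntA nLA ltLK ntL.
by rewrite (setIidPl _) ?(negPf (proper_subn ltLK)) // sub_abelian_norm.
Qed.

(** If [X] is TI, then [C], which normalises [Z], normalises [X]. If [X] were subnormal, it would
    contain [K], impossible inside [C]. *)
Lemma Frobenius_compl_supergroup_normal Z X :
    Z <| C -> p.-group Z -> Z :!=: 1 -> Z \subset X -> X \subset C -> X <| C.
Proof.
move=> /andP[sZC nZC] pZ ntZ sZX sXC.
have [defG ntK _ _ _] := Frobenius_context frobG.
have [_ sCG _ _ tiKC] := sdprod_context defG.
have [||tiX|snX] := @hypG X; first exact: subset_trans sCG.
- have [_ dvZ _] := pgroup_pdiv pZ ntZ.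
  exact: dvdn_trans dvZ (cardSg sZX).
- rewrite /normal sXC (subset_trans _ (TI_subgroup_norm_sub tiX sZX ntZ)) //.
  by rewrite subsetI sCG.
have /setIidPl sKC: K \subset C.
  exact: subset_trans (subnormal_sub_Frobenius_ker snX sZC ntZ sZX) sXC.
by rewrite -sKC tiKC eqxx in ntK.
Qed.

Lemma Frobenius_compl_even :
  p = 2 -> abelian K ->
  exists a, [/\ prime #|K|, odd #|K|, ~~ odd #[a] & C :=: <[a]>].
Proof.
move=> p2 cKK; have [defG ntK _ _ _] := Frobenius_context frobG.
have [_ _ _ nKC _] := sdprod_context defG.
have [t Ct ot] := Cauchy p_pr pC; have ot2 := etrans ot p2.
have /mingroupP[_ minKt]: minnormal K <[t]>.
  apply: Frobenius_ker_minnormal; rewrite ?cycle_subG //.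
    by rewrite /pgroup -orderE ot pnat_id.
  by rewrite cycle_eq1 -order_gt1 ot2.
(* The involution [t] inverts [K], so it normalises every [<[k]>]. By irreducibility one of prime
   order is all of [K]. *)
have prK: prime #|K|.
  have q_pr: prime (pdiv #|K|) by rewrite pdiv_prime ?cardG_gt1.
  have [k Kk ok] := Cauchy q_pr (pdiv_dvd #|K|).
  rewrite -(minKt <[k]>%G) /= ?cycle_subG -?orderE ?ok //.
  rewrite cycle_eq1 -order_gt1 ok prime_gt1 //=.
  apply/normP; rewrite -cycleJ (Frobenius_invol_inverts frobG cKK Ct ot2 Kk).
  by rewrite cycleV.
have /cyclicP[a defC]: cyclic C.
  apply: faithful_prime_cyclic prK nKC _.
  by apply: cent_semiregular (Frobenius_reg_compl frobG) _ ntK.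
exists a; split=> //; last by rewrite -dvdn2 /order -defC -p2.
by rewrite -coprimen2; apply: coprime_dvdr (Frobenius_coprime frobG); rewrite -p2.
Qed.

Lemma Frobenius_compl_odd P q :
    2 < p -> prime q -> q.-abelem K -> p.-Sylow(C) P -> P <| C ->
  exists H : {group gT}, [/\ P ><| H = C, cyclic P, cyclic_or_Q8_x_odd H
                           & [~: P, H] != 1 -> #|P| = p].
Proof.
move=> p_gt2 q_pr abelK sylP nsPC; have [sPC pP _] := and3P sylP.
have dvP: p %| #|P|.
  rewrite (card_Hall sylP) p_part -{1}(expn1 p) dvdn_exp2l //.
  by rewrite logn_gt0 mem_primes p_pr cardG_gt0.
have ntP: P :!=: 1.
  by rewrite -cardG_gt1; apply: leq_trans (prime_gt1 p_pr) (dvdn_leq _ dvP).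
have oddP := odd_pgroup_gt2 p_pr p_gt2 pP.
have cycP: cyclic P.
  rewrite (odd_pgroup_rank1_cyclic pP oddP).
  exact: Frobenius_compl_rank1 frobG q_pr abelK sPC.
(* The smallest nontrivial subgroup of [P]. It is normal in [C], so every subgroup of [C] above it
   is normal in [C]. *)
pose Z := 'Ohm_1(P)%G.
have oZ: #|Z| = p := Ohm1_cyclic_pgroup_prime cycP pP ntP.
have ntZ: Z :!=: 1 by rewrite -cardG_gt1 oZ prime_gt1.
have sZP: Z \subset P := Ohm_sub 1 P.
have nsZC: Z <| C by apply: gFnormal_trans.
have nsC X: Z \subset X -> X \subset C -> X <| C.
  exact: Frobenius_compl_supergroup_normal nsZC (pgroupS sZP pP) ntZ.
have /splitsP[H complH] := SchurZassenhaus_split (pHall_Hall sylP) nsPC.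
have [tiPH mulPH] := complP complH.
have sHC: H \subset C by rewrite -mulPH mulG_subr.
have nPH: H \subset 'N(P) := subset_trans sHC (normal_norm nsPC).
have defC: P ><| H = C by rewrite sdprodE.
have coPH: coprime #|P| #|H|.
  by have := pHall_Hall sylP; rewrite (coprime_sdprod_Hall_l defC).
have tiZH: Z :&: H = 1 by apply/trivgP; rewrite -tiPH setSI.
have nsZX X: X \subset H -> Z <*> X <| C.
  by move=> sXH; rewrite nsC ?joing_subl // join_subG normal_sub ?(subset_trans sXH).
have nZH: H \subset 'N(Z) := subset_trans sHC (normal_norm nsZC).
(* [X] is recovered as the intersection of [Z <*> X], normal in [C], with [H]. *)
have nsH X: X \subset H -> X <| H.
  move=> sXH; rewrite /normal sXH; have /andP[_ nZXC] := nsZX X sXH.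
  suffices <-: (Z <*> X) :&: H = X.
    by rewrite normsI ?normG ?(subset_trans sHC).
  rewrite norm_joinEr ?(subset_trans sXH) // setIC -group_modr // setIC tiZH.
  exact: mul1g.
have clsH := Frobenius_compl_cyclic_or_Q8_x_odd frobG q_pr abelK sHC nsH.
exists H; split=> // ncPH; rewrite -oZ.
have [<- //|neZP] := eqVneq (Z : {set gT}) P.
case/eqP: ncPH; apply: (cyclic_Sylow_coprime_comm1 cycP pP (erefl _) neZP nPH coPH).
(* As [P] and [Z <*> H] are both normal in [C], [[~: P, H]] lies in their intersection, which is
   [Z]. *)
have nsHZ := nsZX H (subxx H).
have ->: Z :=: P :&: (Z <*> H).
  by rewrite norm_joinEr // setIC -group_modl // setIC tiPH mulg1.
rewrite subsetI commg_subl nPH /=.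
apply: subset_trans (commgS P (joing_subr Z H)) _.
by rewrite commg_subr (subset_trans sPC) // normal_norm.
Qed.

End Kernel.

(** * The converse for cases (2), (3) and (4) *)

Lemma prime_ker_TI_or_normal G K C p :
    prime p -> p %| #|C| -> [Frobenius G = K ><| C] -> prime #|K| -> abelian C ->
  forall X, X \subset G -> p %| #|X| -> TI_subgroup X G \/ X <| G.
Proof.
move=> p_pr pC frobG prK cCC.
have solK := abelian_sol (cyclic_abelian (prime_cyclic prK)).
have [defG ntK _ _ _] := Frobenius_context frobG.
have [_ _ _ nKC _] := sdprod_context defG.
apply: (Frobenius_TI_or_normal p_pr pC frobG solK) => Y sYC _.
split; first by rewrite -sub_abelian_normal.
apply/mingroupP; rewrite ntK (subset_trans sYC) //; split=> // L /andP[ntL _] sLK.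
by apply/eqP; rewrite eqEsubset sLK prime_meetG // (setIidPr sLK).
Qed.

Lemma dprod_compl_TI_or_normal G K P H C p :
    prime p -> 2 < p -> p %| #|G| -> solvable K -> [Frobenius G = K ><| C] ->
    P \x H = C -> p.-Sylow(G) P -> cyclic P -> cyclic_or_Q8_x_odd H ->
    (forall X, X \subset P -> X :!=: 1 -> minnormal K X) ->
  forall X, X \subset G -> p %| #|X| -> TI_subgroup X G \/ X <| G.
Proof.
move=> p_pr p_gt2 pG solK frobG defC sylP cycP clsH irrP.
have [defG _ _ _ _] := Frobenius_context frobG.
have [_ sCG _ nKC _] := sdprod_context defG.
have [nsPC _] := dprod_normal2 defC.
have sPC := normal_sub nsPC.
have sylPC := pHall_subl sPC sCG sylP.
have oddP := odd_pgroup_gt2 p_pr p_gt2 (pHall_pgroup sylP).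
have pC: p %| #|C|.
  apply: dvdn_trans (cardSg sPC); rewrite (card_Hall sylP) p_part.
  by rewrite -{1}(expn1 p) dvdn_exp2l // logn_gt0 mem_primes p_pr cardG_gt0.
apply: (Frobenius_TI_or_normal p_pr pC frobG solK) => Y sYC pY.
split; first exact: dprod_cyclic_normal_subgroups defC clsH sYC.
have ntI := normal_Sylow_meet p_pr sylPC nsPC sYC pY.
apply: minnormalS (subsetIl Y P) (subset_trans sYC nKC) _.
by rewrite irrP ?subsetIr.
Qed.

Lemma sdprod_compl_TI_or_normal G K Z H C p :
    prime p -> solvable K -> [Frobenius G = K ><| C] ->
    Z ><| H = C -> p.-Sylow(G) Z -> #|Z| = p -> cyclic_or_Q8_x_odd H ->
    minnormal K Z ->
  forall X, X \subset G -> p %| #|X| -> TI_subgroup X G \/ X <| G.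
Proof.
move=> p_pr solK frobG defC sylZ oZ clsH irrZ.
have [defG _ _ _ _] := Frobenius_context frobG.
have [_ sCG _ nKC _] := sdprod_context defG.
have [nsZC sHC mulZH nZH tiZH] := sdprod_context defC.
have sZC := normal_sub nsZC.
have sylZC := pHall_subl sZC sCG sylZ.
have pC: p %| #|C| by rewrite -oZ cardSg.
apply: (Frobenius_TI_or_normal p_pr pC frobG solK) => Y sYC pY.
have sZY: Z \subset Y.
  by rewrite prime_meetG ?oZ // setIC (normal_Sylow_meet p_pr sylZC).
split; last first.
  exact: minnormalS sZY (subset_trans sYC nKC) irrZ.
(* [Z] normalises [Y] because it lies in [Y], and [H] does because it normalises both factors. *)
have defY: Z * (Y :&: H) = Y by rewrite setIC group_modl // mulZH; apply/setIidPr.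
have nsYH := cyclic_or_Q8_x_odd_normal_subgroups clsH (subsetIr Y H).
rewrite /normal sYC -{1}mulZH mul_subG ?(subset_trans sZY) ?normG //.
by rewrite -defY normsM // normal_norm.
Qed.

End General.

(** * Assembly of the two directions *)

Theorem theorem1p1 (gT : finGroupType) (G : {group gT}) (p : nat) :
  prime p -> p %| #|G| ->
  ((forall H : {group gT}, H \subset G ->
      TI_subgroup H G \/ H <|<| G \/ ~~ (p %| #|H|))
   <->
   [\/ (* (1) *)
       (forall H : {group gT}, H \subset G -> p %| #|H| -> H <|<| G),
       (* (2) *)
       p = 2 /\
       exists (q : nat) (K : {group gT}) (a : gT),
         [/\ prime q, odd q, #|K| = q, ~~ odd #[a]
           & [Frobenius G = K ><| <[a]>]],
       (* (3) *)
       2 < p /\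
       exists (q r : nat) (K P H C : {group gT}),
         [/\ [/\ prime q, q != p & (1 <= r)%N], q.-abelem K /\ #|K| = (q ^ r)%N,
             ([Frobenius G = K ><| C]) /\ (P \x H = C),
             (P \in 'Syl_p(G) /\ cyclic P) /\ cyclic_or_Q8_x_odd H
           & forall X : {group gT}, X \subset P -> X :!=: 1 ->
               acts_irreducibly X K 'J]
     | (* (4) *)
       2 < p /\
       exists (q r : nat) (K Z H C : {group gT}),
         [/\ [/\ prime q, q != p & (1 < r)%N], q.-abelem K /\ #|K| = (q ^ r)%N,
             ([Frobenius G = K ><| C]) /\ (Z ><| H = C),
             (Z \in 'Syl_p(G) /\ #|Z| = p) /\
             (cyclic_or_Q8_x_odd H /\ [~: Z, H] != 1)
           & acts_irreducibly Z K 'J]]).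
Proof.
move=> p_pr pG; split=> [hyp | clsG X sXG].
  have hypG (X : {group gT}) :
    X \subset G -> p %| #|X| -> TI_subgroup X G \/ X <|<| G.
  - by move=> sXG pX; have [|[|]] := hyp X sXG; [left | right | rewrite pX].
  have [P sylP] := Sylow_exists p G.
  have [nsPG|nnPG] := boolP (P <| G).
    by constructor 1; apply: TI_or_subnormal_normal_Sylow sylP nsPG hypG.
  have [K frobG] := nonnormal_Sylow_Frobenius sylP pG nnPG hypG.
  set C := 'N_G(P)%G in frobG.
  have [sPG pP _] := and3P sylP.
  have ntP: P :!=: 1 by apply: contraNneq nnPG => ->; apply: normal1.
  have [_ dvP _] := pgroup_pdiv pP ntP.
  have nsPC: P <| C by rewrite normalSG.
  have sPC := normal_sub nsPC; have sCG: C \subset G := subsetIl _ _.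
  have pC: p %| #|C| := dvdn_trans dvP (cardSg sPC).
  have [defG ntK _ _ _] := Frobenius_context frobG.
  have [_ _ _ nKC _] := sdprod_context defG.
  have [q q_pr abelK] := Frobenius_ker_abelem p_pr frobG pC hypG sPC pP ntP.
  have cKK := abelem_abelian abelK.
  have [_ qdvK [r oK]] := pgroup_pdiv (abelem_pgroup abelK) ntK.
  have [p2|odd_p] := even_prime p_pr.
    have [a [prK oddK oa defC]] := Frobenius_compl_even p_pr frobG pC hypG p2 cKK.
    by constructor 2; split=> //; exists #|K|, K, a; rewrite -defC.
  have p_gt2: 2 < p by rewrite odd_prime_gt2.
  have sylPC: p.-Sylow(C) P := pHall_subl sPC sCG sylP.
  have [H [defC cycP clsH oP]] :=
    Frobenius_compl_odd p_pr frobG pC hypG p_gt2 q_pr abelK sylPC nsPC.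
  have q_neq_p: q != p.
    have:= Frobenius_ker_p'group p_pr frobG pC; rewrite /pgroup p'natE //.
    by apply: contraNneq => <-.
  have irrP (X : {group gT}) :
    X \subset P -> X :!=: 1 -> acts_irreducibly X K 'J.
  - move=> sXP ntX; rewrite acts_irreducibly_conj.
    apply: (Frobenius_ker_minnormal p_pr frobG pC hypG cKK) => //.
      exact: subset_trans sPC.
    exact: pgroupS pP.
  have [cPH|ncPH] := eqVneq [~: P, H] 1.
    constructor 3; split=> //; exists q, r.+1, K, P, H, C; split=> //.
      split=> //; have [_ mulPH _ tiPH] := sdprodP defC.
      by rewrite dprodE // centsC; apply/commG1P.
    by rewrite inE.
  constructor 4; split=> //; exists q, r.+1, K, P, H, C.
  split=> //; last exact: irrP.
    (* The rank is [r.+1]. If [r = 0], then [K] has prime order, so [C] embeds in its cyclic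
       automorphism group and [[~: P, H]] is trivial. *)
    split=> //; rewrite ltnS lt0n; apply: contraNneq ncPH => r0.
    have sHC: H \subset C by have [] := sdprod_context defC.
    have /cyclic_abelian cCC: cyclic C.
      apply: (@faithful_prime_cyclic _ K); rewrite ?oK ?r0 ?expn1 //.
      by apply: cent_semiregular (Frobenius_reg_compl frobG) _ ntK.
    by apply/eqP/commG1P/(subset_trans sPC)/(subset_trans cCC)/centS.
  by split; [rewrite inE sylP oP | split].
have [pX|p'X] := boolP (p %| #|X|); last by right; right.
have TI_or_normal (Q : Prop) :
  TI_subgroup X G \/ X <| G -> TI_subgroup X G \/ X <|<| G \/ Q.
- by case=> [|/normal_subnormal]; [left | right; left].
case: clsG => [snG | [p2 [q [K [a [q_pr _ oK oa frobG]]]]] | | ].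
- by right; left; apply: snG.
- apply: TI_or_normal; apply: (prime_ker_TI_or_normal p_pr _ frobG) => //.
  + by rewrite p2 -orderE dvdn2.
  + by rewrite oK.
  exact: cycle_abelian.
- case=> p_gt2 [q [r [K [P [H [C [_ [abelK _] [frobG defC]]]]]]]].
  rewrite inE => -[[sylP cycP] clsH] irrP.
  have solK := abelian_sol (abelem_abelian abelK).
  apply: TI_or_normal; apply: (dprod_compl_TI_or_normal p_pr p_gt2 pG solK frobG defC
    sylP cycP clsH) => //.
  by move=> Y sYP ntY; rewrite -acts_irreducibly_conj irrP.
case=> _ [q [r [K [Z [H [C [_ [abelK _] [frobG defC]]]]]]]].
rewrite inE acts_irreducibly_conj => -[[sylZ oZ] [clsH _]] irrZ.
have solK := abelian_sol (abelem_abelian abelK).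
apply: TI_or_normal.
exact: sdprod_compl_TI_or_normal p_pr solK frobG defC sylZ oZ clsH irrZ _ sXG pX.
Qed.
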